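(* Let $R$ be a principal ideal domain and $n$ a positive integer. Any finite subset $J\subset\mathrm{M}(n,R)^\times$ has a least common multiple (unique up to right multiplication by an element of $\mathrm{GL}(n,R)$): there exists $L\in\mathrm{M}(n,R)^\times$ such that (1) $X\mid_l L$ for all $X\in J$, and (2) if $L'\in\mathrm{M}(n,R)^\times$ satisfies $X\mid_l L'$ for all $X\in J$, then $L\mid_l L'$.
   Context: $\mathrm{M}(n,R)^\times=\{X\in\mathrm{M}(n,R)\mid\det(X)\ne0\}$, a monoid under matrix multiplication. For $X,Y\in\mathrm{M}(n,R)^\times$, $X\mid_l Y$ means that there exists $Z\in\mathrm{M}(n,R)^\times$ with $XZ=Y$. A least common multiple of $J\subset\mathrm{M}(n,R)^\times$ is an element $L$ satisfying (1) and (2) of the claim. *)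

(* Defs.v *)
From HB Require Import structures.
From mathcomp Require Import all_boot all_order all_algebra.
From mathcomp Require Import all_classical.

Set Implicit Arguments.
Unset Strict Implicit.
Unset Printing Implicit Defensive.

Import GRing.Theory.
Local Open Scope classical_set_scope.
Local Open Scope ring_scope.

(* The improper ideal [set: R] is allowed, unlike in ring_quotient's
   [idealr_closed], which requires 1 to lie outside the ideal. *)
Definition is_ideal (R : comNzRingType) (I : set R) : Prop :=
  [/\ I 0, forall x y, I x -> I y -> I (x + y) & forall a x, I x -> I (a * x)].

(* To be used with [R : idomainType]: this is only the condition on ideals. *)
Definition all_ideals_principal (R : comNzRingType) : Prop :=
  forall I : set R, is_ideal I -> exists a, I = [set r * a | r in [set: R]].

(* The monoid M(n, R)^x: nonzero determinant, not invertibility ([unitmx] is GL(n, R)). *)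
Definition nonsing (R : comNzRingType) (n : nat) : set 'M[R]_n :=
  [set X | \det X != 0].
Arguments nonsing : clear implicits.

Definition ldvdmx (R : comNzRingType) (n : nat) (X Y : 'M[R]_n) : Prop :=
  exists2 Z, nonsing R n Z & X *m Z = Y.

Definition is_lcm (R : comNzRingType) (n : nat)
    (J : set 'M[R]_n) (L : 'M[R]_n) : Prop :=
  [/\ nonsing R n L,
      forall X, J X -> ldvdmx X L
    & forall L', nonsing R n L' -> (forall X, J X -> ldvdmx X L') ->
        ldvdmx L L'].

(* Main.v *)
Require Import Defs.
From mathcomp Require Import all_boot all_order all_algebra.
From mathcomp Require Import all_classical.
Local Open Scope classical_set_scope.
Local Open Scope ring_scope.

(** Left divisibility is reverse inclusion of column modules: for nonsingular
  [X] and [Y], [X] divides [Y] exactly when the module spanned by the columns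
  of [Y] lies in the one spanned by the columns of [X]
  ([ldvdmx_colmod], [colmod_ldvdmx]). A least common multiple of [J] is therefore
  a nonsingular matrix whose column module is the intersection [M] of the
  column modules of the members of [J].

  Over a principal ideal domain every submodule of [R^n] is spanned by the
  columns of some n x n matrix ([submod_pid_colmod]), so [M] is the column
  module of some [L]. This [L] is nonsingular because [M] has full rank: if
  [d] is the product of the determinants of the finitely many members of [J],
  then [d *: v] is in [M] for all [v], by Cramer's rule, so [L] divides the
  nonzero scalar matrix [d%:M].

  Uniqueness holds because two least common multiples divide each other, and
  then the determinants of the two quotients multiply to 1, so that the
  quotients are invertible ([ldvdmx_antisym]). *)

Import GRing.Theory.

Definition is_submod {R : pzRingType} {V : lmodType R} (M : set V) : Prop :=
  [/\ M 0, forall u v, M u -> M v -> M (u + v)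
    & forall (a : R) v, M v -> M (a *: v)].

Definition colmod {R : pzRingType} {n : nat} (X : 'M[R]_n) : set 'cV[R]_n :=
  range (fun u : 'cV[R]_n => X *m u).

Lemma is_submod_bigcap_colmod {R : comNzRingType} {n : nat} (J : set 'M[R]_n) :
  is_submod (\bigcap_(X in J) colmod X).
Proof.
split=> [X _|u v Mu Mv X JX|a v Mv X JX].
- by exists 0; rewrite ?mulmx0.
- have [u' _ <-] := Mu X JX; have [v' _ <-] := Mv X JX.
  by exists (u' + v'); rewrite ?mulmxDr.
- have [v' _ <-] := Mv X JX.
  by exists (a *: v'); rewrite ?scalemxAr.
Qed.

(** Induction on [n], splitting off the first coordinate. The first
  coordinates of the members of [M] form a principal ideal; a member [w] of
  [M] whose first coordinate generates this ideal is the first column, and a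
  multiple of [w] reduces any member of [M] to one with first coordinate 0,
  to which the induction hypothesis applies. The generators need not be
  independent (a column may be 0), which is why exactly [n] of them can be
  requested. *)
Lemma submod_pid_colmod {R : comNzRingType} (pidR : all_ideals_principal R)
    {n : nat} (M : set 'cV[R]_n) :
  is_submod M -> exists L : 'M[R]_n, M = colmod L.
Proof.
elim: n M => [|n IHn] M [M0 MD MZ].
  exists 0; apply/seteqP; split=> v _; last by rewrite [v]flatmx0.
  by exists 0; rewrite // mul0mx [v]flatmx0.
pose I : set R := [set v 0 0 | v in M].
have idI : is_ideal I.
  split=> [|_ _ [u Mu <-] [v Mv <-]|a _ [v Mv <-]].
  - by exists 0; rewrite ?mxE.
  - by exists (u + v); [exact: MD | rewrite mxE].
  - by exists (a *: v); [exact: MZ | rewrite mxE].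
have [a Ia] := pidR I idI.
have [w Mw wa] : I a by rewrite Ia; exists 1; rewrite ?mul1r.
pose M' : set 'cV[R]_n := [set v | M (col_mx (0 : 'cV_1) v : 'cV_(1 + n))].
have [|L' M'E] := IHn M'.
  split=> [|u v Mu Mv|c v Mv]; rewrite /M' /=.
  - by rewrite col_mx0.
  - by rewrite -[0]addr0 -add_col_mx; apply: MD.
  - by rewrite -[0](scaler0 _ c) -scale_col_mx; apply: MZ.
pose L : 'M[R]_(1 + n) := row_mx (w : 'cV_(1 + n)) (col_mx 0 L').
have LE (r : 'cV[R]_1) (u : 'cV_n) :
    L *m col_mx r u = r 0 0 *: (w : 'cV_(1 + n)) + col_mx 0 (L' *m u).
  by rewrite mul_row_col mul_col_mx mul0mx {1}[r]mx11_scalar mul_mx_scalar.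
exists L; apply/seteqP; split=> [v Mv|_ [u _ <-]].
- have [r _ rv] : [set r * a | r in [set: R]] (v 0 0) by rewrite -Ia; exists v.
  pose t : 'cV_(1 + n) := v - r *: w.
  have Mt : M t by rewrite /t -scaleNr; apply: MD => //; apply: MZ.
  have t0 : usubmx t = 0.
    apply/matrixP=> i j; rewrite !ord1 !mxE.
    by rewrite (_ : lshift n 0 = 0) ?wa ?rv ?subrr //; apply/val_inj.
  have [u _ uE] : colmod L' (dsubmx t).
    by rewrite -M'E /M' /= -t0 vsubmxK.
  exists (col_mx r%:M u : 'cV_(1 + n)) => //.
  by rewrite LE uE -t0 vsubmxK !mxE eqxx mulr1n addrC subrK.
- rewrite -[u](@vsubmxK _ 1 n) LE; apply: MD; first exact: MZ.
  change (M' (L' *m dsubmx (u : 'cV_(1 + n)))).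
  by rewrite M'E; exists (dsubmx (u : 'cV_(1 + n))).
Qed.

Lemma ldvdmx_colmod {R : comNzRingType} {n : nat} {X Y : 'M[R]_n} :
  ldvdmx X Y -> colmod Y `<=` colmod X.
Proof. by move=> [Z _ <-] _ [u _ <-]; exists (Z *m u); rewrite ?mulmxA. Qed.

(** The columns of the quotient are the coordinates of the columns of [Y] in
  terms of those of [X]; its determinant is nonzero because it divides that
  of [Y]. *)
Lemma colmod_ldvdmx {R : comNzRingType} {n : nat} (X Y : 'M[R]_n) :
  nonsing R n Y -> colmod Y `<=` colmod X -> ldvdmx X Y.
Proof.
move=> nsY sYX.
have /choice [f fE] : forall j, exists u : 'cV[R]_n, X *m u = col j Y.
  move=> j; have [|u _ uE] := sYX (col j Y); last by exists u.
  by exists (delta_mx j 0); rewrite // colE.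
pose Z := \matrix_(i, j) f j i 0.
have XZ : X *m Z = Y.
  apply/matrixP=> i j; have /matrixP/(_ i 0) := fE j.
  by rewrite !mxE => <-; apply: eq_bigr => k _; rewrite mxE.
exists Z => //; apply: contra_neq nsY => Z0.
by rewrite -XZ det_mulmx Z0 mulr0.
Qed.

(** Cramer's rule: [X *m \adj X] is scalar. The factor [c] stands for the
  determinants of the other matrices of a finite family containing [X]. *)
Lemma dvd_det_colmod {R : comNzRingType} {n : nat} (X : 'M[R]_n) (c : R)
    (v : 'cV[R]_n) :
  colmod X ((\det X * c) *: v).
Proof.
exists (\adj X *m (c *: v)) => //.
by rewrite mulmxA mul_mx_adj mul_scalar_mx scalerA.
Qed.

Lemma ldvdmx_antisym {R : idomainType} {n : nat} (X Y : 'M[R]_n) :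
  nonsing R n X -> ldvdmx X Y -> ldvdmx Y X ->
  exists2 U : 'M[R]_n, U \in unitmx & Y = X *m U.
Proof.
move=> nsX [Z _ XZ] [W _ YW]; exists Z => //.
have /(mulfI nsX) ZW1 : \det X * (\det Z * \det W) = \det X * 1.
  by rewrite mulrA -!det_mulmx XZ YW mulr1.
by rewrite unitmxE; apply/unitrPr; exists (\det W).
Qed.

Lemma is_lcm_exists {R : idomainType} (pidR : all_ideals_principal R)
    {n : nat} (J : set 'M[R]_n) :
  finite_set J -> J `<=` nonsing R n -> exists L : 'M[R]_n, is_lcm J L.
Proof.
move=> /finite_seqP [s Js] nsJ.
have [L ME] := submod_pid_colmod pidR _ (is_submod_bigcap_colmod J).
pose d := \prod_(X <- s) \det X.
have d_neq0 : d != 0.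
  rewrite prodf_seq_neq0; apply/allP=> X sX; apply: nsJ.
  by rewrite Js.
have nsd : nonsing R n d%:M by rewrite /nonsing /= det_scalar expf_neq0.
have Ld : ldvdmx L d%:M.
  apply: colmod_ldvdmx => // _ [v _ <-]; rewrite -ME mul_scalar_mx => X JX.
  have sX : X \in s by move: JX; rewrite Js.
  by rewrite /d (big_rem X sX); apply: dvd_det_colmod.
have nsL : nonsing R n L.
  have [Z _ LZ] := Ld; apply: contra_neq nsd => L0.
  by rewrite -LZ det_mulmx L0 mul0r.
exists L; split=> // [X JX|L' nsL' JL'].
- by apply: colmod_ldvdmx => // v; rewrite -ME; apply.
- apply: colmod_ldvdmx => // v L'v; rewrite -ME => X JX.
  exact: ldvdmx_colmod (JL' X JX) _ L'v.
Qed.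

Theorem theorem4 (R : idomainType) (pidR : all_ideals_principal R)
    (n : nat) (n_gt0 : (0 < n)%N)
    (J : set 'M[R]_n) (J_fin : finite_set J) (J_nonsing : J `<=` nonsing R n) :
  (exists L : 'M[R]_n, is_lcm J L) /\
  (forall L1 L2 : 'M[R]_n, is_lcm J L1 -> is_lcm J L2 ->
     exists2 U : 'M[R]_n, U \in unitmx & L2 = L1 *m U).
Proof.
split=> [|L1 L2 [ns1 J1 min1] [ns2 J2 min2]]; first exact: is_lcm_exists.
by apply: ldvdmx_antisym => //; [apply: min1 | apply: min2].
Qed.
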